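(* Let $N>1$ be an integer, let $(X,\mu)$ be a nonatomic probability space and let $\mathcal{T}$ be an $N$-homogeneous tree-like family on $X$. Let $p>1$, let $0<q<p$, and let $F,f>0$ be real numbers with $f^{p}\leq F$. Then $$\mathcal{B}_{p,q}^{\mathcal{T}}(F,f)=f^{q}.$$
   Context: Let $(X,\mu)$ be a nonatomic probability space and $N>1$ an integer. A set $\mathcal{T}$ of measurable subsets of $X$ is called an $N$-homogeneous tree-like family if: (i) $X\in\mathcal{T}$, and to every $I\in\mathcal{T}$ there corresponds a finite subset $\mathcal{C}(I)\subseteq\mathcal{T}$ containing $N$ elements, each of measure $N^{-1}\mu(I)$, which are pairwise disjoint subsets of $I$ with $I=\bigcup\mathcal{C}(I)$; (ii) $\mathcal{T}=\bigcup_{m\geq0}\mathcal{T}_{(m)}$, where $\mathcal{T}_{(0)}=\{X\}$ and $\mathcal{T}_{(m+1)}=\bigcup_{I\in\mathcal{T}_{(m)}}\mathcal{C}(I)$; (iii) $\mathcal{T}$ differentiates $L^{1}(X,\mu)$, i.e. for every $\psi\in L^1(X,\mu)$ and $\mu$-almost every $x$, the averages $\frac{1}{\mu(I)}\int_I\psi\,d\mu$ over $I\in\mathcal{T}_{(m)}$ with $x\in I$ converge to $\psi(x)$ as $m\to\infty$. The associated maximal operator is $M_{\mathcal{T}}\psi(x)=\sup\left\{\frac{1}{\mu(I)}\int_{I}|\psi|\,d\mu: x\in I\in\mathcal{T}\right\}$ for $\psi\in L^{1}(X,\mu)$. Define $$\mathcal{B}_{p,q}^{\mathcal{T}}(F,f)=\inf\left\{\int_{X}(M_{\mathcal{T}}\phi)^{q}\,d\mu:\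 \phi\geq0\text{ measurable},\ \int_{X}\phi\,d\mu=f,\ \int_{X}\phi^{p}\,d\mu=F\right\}.$$ *)

(* Defs.v *)
From mathcomp Require Import all_boot all_order all_algebra.
From mathcomp Require Import all_classical all_reals all_analysis.

Set Implicit Arguments.
Unset Strict Implicit.
Unset Printing Implicit Defensive.

Import Order.TTheory GRing.Theory Num.Theory.
Import numFieldNormedType.Exports.

Local Open Scope classical_set_scope.
Local Open Scope ring_scope.
Local Open Scope ereal_scope.

Section TreeLikeFamilies.
Context {d : measure_display} {X : measurableType d} {R : realType}.
Variable mu : probability X R.

Definition nonatomic : Prop :=
  forall A : set X, measurable A -> 0 < mu A ->
    exists B : set X,
      [/\ measurable B, B `<=` A, 0 < mu B & mu B < mu A].

(* Used only with [0 < mu I]: division by zero is [+oo] in [\bar R]. *)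
Definition average (psi : X -> R) (I : set X) : \bar R :=
  (\int[mu]_(y in I) (psi y)%:E) / mu I.

Fixpoint tree_level (C : set X -> set (set X)) (m : nat) : set (set X) :=
  if m is m'.+1 then \bigcup_(I in tree_level C m') C I else [set setT].

Definition differentiates_L1 (C : set X -> set (set X)) : Prop :=
  forall psi : X -> R, mu.-integrable setT (EFin \o psi) ->
    {ae mu, forall x, forall I : nat -> set X,
      (forall m, tree_level C m (I m) /\ I m x) ->
      average psi (I m) @[m --> \oo] --> (psi x)%:E}.

(* [C I] is the family of children of [I]; its values outside [T] are
   irrelevant. *)
Definition homogeneous_tree_like (N : nat) (T : set (set X)) : Prop :=
  T `<=` measurable /\
  exists C : set X -> set (set X),
    [/\ T setT /\
        (forall I, T I ->
          [/\ C I `<=` T,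
              (C I #= `I_N)%card,
              (forall J, C I J -> mu J = (N%:R^-1)%:E * mu I),
              trivIset (C I) id
            & I = \bigcup_(J in C I) J]),
        T = \bigcup_m tree_level C m
      & differentiates_L1 C].

Definition tree_maximal (T : set (set X)) (psi : X -> R) (x : X) : \bar R :=
  ereal_sup [set average (fun y => `|psi y|%R) I | I in [set I | T I /\ I x]].

Definition bellman (T : set (set X)) (p q F f : R) : \bar R :=
  ereal_inf [set \int[mu]_x (tree_maximal T phi x `^ q) | phi in
    [set phi : X -> R |
      [/\ measurable_fun setT phi,
          (forall x, (0 <= phi x)%R),
          \int[mu]_x (phi x)%:E = f%:E
        & \int[mu]_x (phi x `^ p)%:E = F%:E]]].

End TreeLikeFamilies.

(* Main.v *)
Require Import Defs.
From mathcomp Require Import all_boot all_order all_algebra.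
From mathcomp Require Import all_classical all_reals all_analysis.
From mathcomp Require Import measurable_realfun.
From mathcomp Require Import lra.

Set Implicit Arguments.
Unset Strict Implicit.
Unset Printing Implicit Defensive.

Import Order.TTheory GRing.Theory Num.Theory.
Import numFieldNormedType.Exports.

Local Open Scope classical_set_scope.
Local Open Scope ring_scope.

(** The lower bound holds for every competitor [phi]: [X] itself belongs to the
tree, so the maximal function is everywhere at least the mean of [phi] over
[X], which is [f].

For the upper bound, all the excess mass is put on one very small tree
element. Follow a branch [B 0 = X, B 1, B 2, ...] of the tree, [B m] having
measure [N ^- m], and take [phi = u + w * \1_(B m)]. By the intermediate value
theorem the two moments can be prescribed with [u <= f] once [m] is large
([two_value_moments]). Elements of the tree are nested or disjoint, so a tree
element [I] that meets [B m] is either an ancestor [B k] of it, over which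
[phi] has mean [u + w * N ^ k / N ^ m], or is contained in it; hence at [x] the
maximal function is at most [f + h x], where [h x] is the largest
[w * N ^ k / N ^ m] with [k <= m] and [x] in [B k] ([average_peak_le]).

It remains to see that [h] is negligible. For each [s > 0],
[(f + h) ^ q <= (f + s) ^ q + K * h ^ q] with [K] depending on [f], [s] and [q]
only ([ler_powRD_split]), and [h ^ q] is at most the sum over [k <= m] of
[(w * N ^ k / N ^ m) ^ q * \1_(B k)]. The p-th moment forces
[w ^ p <= F * N ^ m], which with [q < p] and [1 < p] bounds the integral of each
summand by a fixed multiple of [r ^ m] with [r < 1] ([peak_term_le]). So the
whole sum is [O((m + 1) * r ^ m)] and vanishes as [m] grows; then [s] tends
to 0. *)

(** * Inequalities and limits for real powers *)

Section RealLemmas.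
Context {R : realType}.
Implicit Types (a b f h q r s x z : R) (k m n : nat).

(** The right-hand side is the sum of the geometric series, whose first [m + 1]
terms are all at least [r ^+ m]. *)
Lemma ler_natM_expr_geometric r m : 0 <= r < 1 ->
  m.+1%:R * r ^+ m <= (1 - r)^-1.
Proof.
move=> /andP[r0 r1].
have r10 : 0 < 1 - r by rewrite subr_gt0.
have -> : (1 - r)^-1 = (1 - r ^+ m.+1) / (1 - r) + r ^+ m.+1 / (1 - r).
  by rewrite -mulrDl subrK mul1r.
have -> : (1 - r ^+ m.+1) / (1 - r) = \sum_(i < m.+1) r ^+ i.
  apply: (mulIf (lt0r_neq0 r10)); rewrite divfK ?lt0r_neq0//.
  by rewrite mulrC -opprB (subrX1 r) -mulNr opprB.
apply: (@le_trans _ _ (\sum_(i < m.+1) r ^+ i)); last first.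
  by rewrite lerDl divr_ge0 ?exprn_ge0// ltW.
rewrite mulr_natl -[X in _ *+ X]card_ord -sumr_const ler_sum// => i _.
by rewrite ler_wiXn2l// ?ltW// -ltnS.
Qed.

Lemma cvg_natM_expr r : 0 <= r < 1 ->
  (fun m => m.+1%:R * r ^+ m) @ \oo --> (0 : R).
Proof.
move=> /andP[r0 r1].
(* One factor [t ^+ m] absorbs [m + 1]; the other one tends to 0. *)
pose t := Num.sqrt r.
have t0 : 0 <= t by exact: sqrtr_ge0.
have t1 : t < 1 by rewrite -sqrtr1 ltr_sqrt.
have rE : r = t * t by rewrite -expr2 sqr_sqrtr.
apply: (@squeeze_cvgr _ _ _ _ (cst 0) (fun m => (1 - t)^-1 * t ^+ m)).
- near=> m; rewrite mulr_ge0 ?ler0n ?exprn_ge0//= rE exprMn mulrA.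
  by rewrite ler_wpM2r ?exprn_ge0// ler_natM_expr_geometric// t0.
- exact: cvg_cst.
- rewrite -(mulr0 (1 - t)^-1); apply: cvgMr; apply: cvg_expr.
  by rewrite ger0_norm.
Unshelve. all: by end_near. Qed.

(** A perturbation [h <= s] is absorbed in [f + s]; otherwise
[f + h <= (f / s) * h + h]. This replaces subadditivity of the power, which
fails for [q > 1], and keeps the constant 1 in front of [(f + s) ^ q]. *)
Lemma ler_powRD_split f s h q : 0 < f -> 0 < s -> 0 <= h -> 0 <= q ->
  (f + h) `^ q <= (f + s) `^ q + (1 + f / s) `^ q * h `^ q.
Proof.
move=> f0 s0 h0 q0; have fs0 : 0 <= f / s by rewrite divr_ge0 ?ltW.
have [hs|sh] := leP h s.
  apply: (@le_trans _ _ ((f + s) `^ q)).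
    by rewrite ge0_ler_powR ?nnegrE ?addr_ge0 ?lerD2l// ltW.
  by rewrite lerDl mulr_ge0 ?powR_ge0.
rewrite -powRM ?addr_ge0//.
apply: (@le_trans _ _ (((1 + f / s) * h) `^ q)); last by rewrite lerDr powR_ge0.
rewrite ge0_ler_powR ?nnegrE ?mulr_ge0 ?addr_ge0 ?(ltW f0)//.
rewrite mulrDl mul1r addrC lerD2l mulrAC ler_pdivlMr//.
by rewrite ler_wpM2l ?ltW.
Qed.

Lemma natr_powRN_lt1 N (c : R) : (1 < N)%N -> 0 < c ->
  0 <= N%:R `^ (- c) < 1.
Proof.
move=> N1 c0; have n0 : 0 < N%:R :> R by rewrite ltr0n ltnW.
have l0 : 0 < ln (N%:R : R) by rewrite ln_gt0// ltr1n.
rewrite powR_ge0/= /powR gt_eqF// -[ltRHS]expR0 ltr_expR.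
by rewrite mulNr oppr_lt0 mulr_gt0.
Qed.

Lemma continuous_powR p a : 0 < a -> {for a, continuous (fun x : R => x `^ p)}.
Proof.
move=> a0; apply: differentiable_continuous; apply/derivable1_diffP.
by apply: derivable_powR; rewrite in_itv /= a0.
Qed.

(** The two-valued functions [u + w * \1_A] with [mu A = s] realise every p-th
moment [F] between that of the constant [f] and the one reached at
[w = f / (2 * s)], by continuity in [w] along the line of mean [f]; the latter
moment is at least [w ^ p * s], the upper bound assumed on [F]. Stopping at this
[w] keeps [u >= f / 2 > 0], where the power is differentiable, hence
continuous. *)
Lemma two_value_moments p F f s : 0 < s <= 1 -> 0 <= p -> 0 < f ->
  f `^ p <= F -> F <= s * (f / (2 * s)) `^ p ->
  exists u w, [/\ 0 < u, 0 <= w, u <= f, u + w * s = f &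
    u `^ p + ((u + w) `^ p - u `^ p) * s = F].
Proof.
move=> /andP[s0 s1] p0 f0 fF Fs.
have w0 : 0 <= f / (2 * s) by rewrite divr_ge0 ?mulr_ge0 ?ltW.
pose G w := (f - w * s) `^ p + ((f - w * s + w) `^ p - (f - w * s) `^ p) * s.
have upos w : w \in `[0, f / (2 * s)] -> 0 < f - w * s.
  rewrite in_itv /= => /andP[_]; rewrite ler_pdivlMr ?mulr_gt0// => ?.
  nra.
have cG : {within `[0, f / (2 * s)], continuous G}.
  apply: continuous_in_subspaceT => w /set_mem wI; have u0 := upos _ wI.
  have wge0 : 0 <= w by move: wI => /=; rewrite in_itv => /andP[].
  have c1 : f - y * s @[y --> w] --> f - w * s.
    by apply: cvgB; [exact: cvg_cst|apply: cvgMl; exact: cvg_id].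
  have c2 : f - y * s + y @[y --> w] --> f - w * s + w.
    by apply: (cvgD c1); exact: cvg_id.
  have e1 : (f - y * s) `^ p @[y --> w] --> (f - w * s) `^ p.
    exact: (@cvg_comp _ _ _ _ (fun x => x `^ p) _ _ _ c1 (continuous_powR u0)).
  have e2 : (f - y * s + y) `^ p @[y --> w] --> (f - w * s + w) `^ p.
    apply: (@cvg_comp _ _ _ _ (fun x => x `^ p) _ _ _ c2).
    by apply: continuous_powR; rewrite ltr_wpDr.
  by apply: (cvgD e1); apply: cvgMl; exact: (cvgB e2 e1).
have G0 : G 0 = f `^ p by rewrite /G !mul0r subr0 addr0 subrr mul0r addr0.
have G1 : F <= G (f / (2 * s)).
  apply: (le_trans Fs); rewrite /G.
  set w := f / (2 * s) in w0 *; have wI : w \in `[0, f / (2 * s)].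
    by rewrite in_itv /= w0 lexx.
  have u0 := upos _ wI.
  have : w `^ p <= (f - w * s + w) `^ p.
    apply: ge0_ler_powR; rewrite ?nnegrE ?lerDr ?(ltW u0)//.
    by rewrite (addr_ge0 (ltW u0)).
  by have := powR_ge0 (f - w * s) p; nra.
have {w0} [w wI wF] : exists2 c, c \in `[0, f / (2 * s)] & G c = F.
  by apply: IVT => //; rewrite G0 ge_min le_max fF G1 orbT.
have u0 := upos _ wI; have wge0 : 0 <= w by move: wI; rewrite in_itv => /andP[].
exists (f - w * s), w; split => //.
  by rewrite lerBlDr lerDl mulr_ge0// ltW.
by rewrite subrK.
Qed.

(** Since [b <= (F * N ^ m) ^ (1 / p)], the left-hand side is at most
[F ^ (q / p)] times [N] to the power
[- ((m - k) * (q - q / p) + k * (1 - q / p))]: minus [m] times a convex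
combination of the two numbers whose minimum appears on the right. *)
Lemma peak_term_le N p q F b k m : (1 < N)%N -> 0 < p -> 0 < q ->
  0 <= F -> 0 <= b -> (k <= m)%N -> b `^ p * N%:R ^- m <= F ->
  (b * (N%:R ^+ k / N%:R ^+ m)) `^ q * N%:R ^- k <=
  F `^ (q / p) * (N%:R `^ (- Num.min (1 - q / p) (q - q / p))) ^+ m.
Proof.
move=> N1 p0 q0 F0 b0 km bF.
have n1 : 1 <= N%:R :> R by rewrite ler1n ltnW.
have n0 : 0 < N%:R :> R by rewrite (lt_le_trans _ n1).
have nX k' : N%:R ^+ k' = N%:R `^ k'%:R :> R by rewrite powR_mulrn// ltW.
have nD x y : N%:R `^ (x + y) = N%:R `^ x * N%:R `^ y :> R.
  by rewrite powRD// (gt_eqF n0) implybT.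
have bq : b `^ q <= F `^ (q / p) * N%:R `^ (m%:R * (q / p)).
  have -> : b `^ q = (b `^ p) `^ (q / p).
    by rewrite -powRrM mulrCA divff ?mulr1// gt_eqF.
  rewrite (powRrM N%:R) -powRM ?powR_ge0//.
  apply: ge0_ler_powR;
    rewrite ?nnegrE ?mulr_ge0 ?powR_ge0 ?invr_ge0 ?(ltW p0) ?(ltW q0)//.
  by rewrite -nX -ler_pdivrMr ?exprn_gt0.
rewrite -powR_mulrn ?powR_ge0// -powRrM !nX -!powRN -nD.
rewrite powRM ?powR_ge0// -powRrM -mulrA -nD.
apply: (le_trans (ler_wpM2r (powR_ge0 _ _) bq)).
rewrite -mulrA -nD ler_wpM2l ?powR_ge0// ler_powR//.
set t := q / p; set c := Num.min _ _.
have c1 : c <= 1 - t by rewrite ge_min lexx.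
have c2 : c <= q - t by rewrite ge_min lexx orbT.
have km' : k%:R <= m%:R :> R by rewrite ler_nat.
have k0 : 0 <= k%:R :> R by rewrite ler0n.
have := ler_wpM2l k0 c1.
have mk0 : 0 <= m%:R - k%:R :> R by rewrite subr_ge0.
have := ler_wpM2l mk0 c2.
lra.
Qed.

End RealLemmas.

(** * Integrals of nonnegative functions *)

Section Integrals.
Context {d : measure_display} {X : measurableType d} {R : realType}.

(** The integral of a nonnegative function is a supremum over the simple
functions below it, so it is monotone even on functions not known to be
measurable, such as a maximal function. *)
Lemma ge0_le_integralT (mu : measure X R) (g h : X -> \bar R) :
  (forall x, 0 <= g x)%E -> (forall x, g x <= h x)%E ->
  (\int[mu]_x g x <= \int[mu]_x h x)%E.
Proof.
move=> g0 gh; have h0 x : (0 <= h x)%E by exact: le_trans (gh x).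
rewrite !ge0_integralTE//; apply: ereal_sup_le => _ [k kg <-].
by exists k => // x; exact: le_trans (gh x).
Qed.

Lemma integral_step (mu : probability X R) (D A : set X) (u w : R) :
  measurable D -> measurable A -> 0 <= u -> 0 <= w ->
  (\int[mu]_(x in D) (u + w * \1_A x)%:E = u%:E * mu D + w%:E * mu (A `&` D))%E.
Proof.
move=> mD mA u0 w0.
have mi : measurable_fun D (EFin \o (\1_A : X -> R)).
  by apply/measurable_EFinP; exact: measurable_indic.
under eq_integral do rewrite EFinD EFinM.
rewrite ge0_integralD//; first last.
- exact: measurable_funeM.
- by move=> x _; rewrite -EFinM lee_fin mulr_ge0.
- rewrite (integral_cst _ mD u%:E) ge0_integralZl ?lee_fin//.
  by rewrite integral_indic.
Qed.

End Integrals.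

(** * Geometry of the tree *)

Section Tree.
Context {d : measure_display} {X : measurableType d} {R : realType}.
Variables (mu : probability X R) (N : nat) (T : set (set X)).
Variable C : set X -> set (set X).
Hypothesis N1 : (1 < N)%N.
Hypothesis Tmeas : T `<=` measurable.
Hypothesis TsetT : T setT.
Hypothesis Tchildren : forall I, T I ->
  [/\ C I `<=` T, (C I #= `I_N)%card,
      (forall J, C I J -> mu J = (N%:R^-1)%:E * mu I)%E,
      trivIset (C I) id
    & I = \bigcup_(J in C I) J].
Hypothesis TE : T = \bigcup_m tree_level C m.

Lemma tree_level_sub m : tree_level C m `<=` T.
Proof. by move=> I mI; rewrite TE; exists m. Qed.

Lemma tree_child_subset I J : T I -> C I J -> J `<=` I.
Proof. by move=> /Tchildren[_ _ _ _ IE] IJ x Jx; rewrite IE; exists J. Qed.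

Lemma tree_level_measure m I : tree_level C m I -> mu I = (N%:R ^- m)%:E.
Proof.
elim: m I => [I ->|m IHm I [J mJ JI]].
  by rewrite probability_setT expr0 invr1.
have [_ _ -> // _ _] := Tchildren (tree_level_sub mJ).
by rewrite (IHm _ mJ) -EFinM -invfM -exprS.
Qed.

Lemma tree_level_eq m I J x :
  tree_level C m I -> tree_level C m J -> I x -> J x -> I = J.
Proof.
elim: m I J => [I J -> ->//|m IHm I J [I' mI' I'I] [J' mJ' J'J] Ix Jx].
have II' := tree_child_subset (tree_level_sub mI') I'I.
have JJ' := tree_child_subset (tree_level_sub mJ') J'J.
have E : J' = I' by apply: IHm => //; [exact: JJ'|exact: II'].
rewrite {J' mJ' JJ'}E in J'J.
have [_ _ _ trivI _] := Tchildren (tree_level_sub mI').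
by apply: trivI => //; exists x.
Qed.

Lemma tree_ancestor k m I : (k <= m)%N -> tree_level C m I ->
  exists2 A, tree_level C k A & I `<=` A.
Proof.
move=> km; rewrite -(subnK km); elim: (m - k)%N I => [I kI|j IHj I [J jJ JI]].
  by exists I.
have [A kA JA] := IHj _ jJ; exists A => //.
exact: subset_trans (tree_child_subset (tree_level_sub jJ) JI) JA.
Qed.

(** Every tree element has a child because [N] is positive; a branch iterates
such a choice from [X]. *)
Lemma tree_branch : exists B : nat -> set X,
  (forall m, tree_level C m (B m)) /\ (forall m, B m.+1 `<=` B m).
Proof.
have /choice[ch chP] I : exists J, T I -> C I J.
  have [TI|nTI] := pselect (T I); last by exists set0.
  have [_ cN _ _ _] := Tchildren TI.
  have /set0P[J IJ] : C I != set0.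
    apply/eqP => C0; move: cN; rewrite C0 card_eq_sym card_eq0.
    by move=> /eqP/seteqP[/(_ 0%N)]/=; move/(_ (ltnW N1)).
  by exists J.
pose B m := iter m ch setT.
have lB m : tree_level C m (B m).
  elim: m => //= m IHm; exists (B m) => //.
  exact/chP/tree_level_sub/IHm.
exists B; split => // m.
by apply: tree_child_subset; [|apply: chP]; exact: tree_level_sub (lB m).
Qed.

(** * The maximal function of a peak *)

Section Peak.
Variable B : nat -> set X.
Hypothesis lB : forall m, tree_level C m (B m).
Hypothesis Bdecr : forall m, B m.+1 `<=` B m.

Let Bmeas m : measurable (B m).
Proof. exact/Tmeas/tree_level_sub/lB. Qed.

(** Let [I], of level [n], contain [x]. If [I] misses [B m], the mean is [u] and
[k = 0] works since [B 0 = X]. If [I] meets [B m] and [n <= m], then [I = B n]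
and [k = n]. If [I] meets [B m] and [m < n], then [I] lies in [B m], the mean
is [u + w], and [k = m]. *)
Lemma average_peak_le (u w : R) m I x : 0 <= u -> 0 <= w -> T I -> I x ->
  exists k, [/\ (k <= m)%N, B k x &
    (average mu (fun y => (`|u + w * \1_(B m) y|)%R) I <=
     (u + w * (N%:R ^+ k / N%:R ^+ m))%R%:E)%E].
Proof.
move=> u0 w0 TI Ix; have [n _ nI] : (\bigcup_m tree_level C m) I by rewrite -TE.
have n0 : 0 < N%:R :> R by rewrite ltr0n ltnW.
have nX0 k : 0 < N%:R ^+ k :> R by rewrite exprn_gt0.
have muI := tree_level_measure nI.
have avgP (t v : R) : mu (B m `&` I) = t%:E -> t <= v * N%:R ^- n ->
    (average mu (fun y => (`|u + w * \1_(B m) y|)%R) I <= (u + w * v)%R%:E)%E.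
  move=> mut tv; rewrite /average.
  under eq_integral do rewrite ger0_norm ?addr_ge0 ?mulr_ge0//.
  rewrite (integral_step _ (Tmeas TI) (@Bmeas m) u0 w0) muI mut.
  rewrite -!EFinM -EFinD inver gt_eqF ?invr_gt0// -EFinM lee_fin invrK.
  rewrite mulrDl divfK ?gt_eqF// lerD2l -mulrA ler_wpM2l//.
  by rewrite -ler_pdivlMr.
have [[z [Bz Iz]]|disj] := pselect (exists z, B m z /\ I z); last first.
  exists 0%N; split => //; first by have -> : B 0%N = setT by exact: lB 0%N.
  apply: (avgP 0); last by rewrite !mulr_ge0// ?invr_ge0 ltW.
  rewrite (_ : _ `&` _ = set0) ?measure0//.
  by apply/eqP; apply: contra_notT disj => /set0P.
have [nm|/ltnW mn] := leqP n m.
  have BmBn : B m `<=` B n.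
    move: nm => /subnK <-; elim: (m - n)%N => // j IHj.
    by rewrite addSn; apply: subset_trans IHj; exact: Bdecr.
  have IB : I = B n by apply: tree_level_eq nI (lB n) Iz (BmBn _ Bz).
  exists n; split => //; first by rewrite -IB.
  apply: (avgP (N%:R ^- m)).
    by rewrite IB setIidl// (tree_level_measure (lB m)).
  by rewrite mulrAC divff ?mul1r// gt_eqF.
have [A mA IA] := tree_ancestor mn nI.
have AB : A = B m by apply: tree_level_eq mA (lB m) (IA _ Iz) Bz.
exists m; split => //; first by rewrite -AB; exact: IA.
apply: (avgP (N%:R ^- n)); first by rewrite setIidr// -AB.
by rewrite divff ?mul1r// gt_eqF.
Qed.

Lemma average_le_tree_maximal (psi : X -> R) I x : T I -> I x ->
  (average mu (fun y => `|psi y|%R) I <= tree_maximal mu T psi x)%E.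
Proof. by move=> TI Ix; apply: ereal_sup_ubound; exists I. Qed.

(** The sum over [k] replaces the maximum: only one of its nonnegative terms is
used to dominate a given average. *)
Lemma tree_maximal_peak_le (u w f s q : R) m x :
  0 <= u <= f -> 0 <= w -> 0 < f -> 0 < s -> 0 < q ->
  (tree_maximal mu T (fun y => (u + w * \1_(B m) y)%R) x `^ q <=
   ((f + s) `^ q + \sum_(k < m.+1)
     (1 + f / s) `^ q * (w * (N%:R ^+ k / N%:R ^+ m)) `^ q * \1_(B k) x)%R%:E)%E.
Proof.
move=> /andP[u0 uf] w0 f0 s0 q0; set V := (X in (X%:E)%E).
have h0 k : 0 <= w * (N%:R ^+ k / N%:R ^+ m) :> R.
  by rewrite mulr_ge0// divr_ge0// exprn_ge0.
have term0 k : 0 <= (1 + f / s) `^ q * (w * (N%:R ^+ k / N%:R ^+ m)) `^ q *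
    \1_(B k) x by rewrite !mulr_ge0// powR_ge0.
have V0 : 0 <= V by rewrite addr_ge0 ?powR_ge0// sumr_ge0.
have VE : V = (V `^ q^-1) `^ q by rewrite -powRrM mulVf ?powRr1// gt_eqF.
rewrite VE -poweR_EFin; apply: gt0_ler_poweR; first exact: ltW.
- rewrite in_itv /= leey andbT.
  apply: le_trans (average_le_tree_maximal _ TsetT (I : [set: X] x)).
  rewrite /average probability_setT inve1 mule1.
  by apply: integral_ge0 => y _; rewrite lee_fin.
- by rewrite in_itv /= leey andbT lee_fin powR_ge0.
apply: ge_ereal_sup => _ [I [TI Ix] <-].
have [k [km Bkx avg_le]] := average_peak_le m u0 w0 TI Ix.
apply: (le_trans avg_le); rewrite lee_fin.
have uh0 : 0 <= u + w * (N%:R ^+ k / N%:R ^+ m) by rewrite addr_ge0.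
have -> : u + w * (N%:R ^+ k / N%:R ^+ m) =
    ((u + w * (N%:R ^+ k / N%:R ^+ m)) `^ q) `^ q^-1.
  by rewrite -powRrM mulfV ?powRr1// gt_eqF.
apply: ge0_ler_powR; rewrite ?nnegrE ?powR_ge0 ?invr_ge0 ?(ltW q0)//.
apply: (@le_trans _ _ ((f + w * (N%:R ^+ k / N%:R ^+ m)) `^ q)).
  apply: ge0_ler_powR; rewrite ?nnegrE ?lerD2r ?(ltW q0)//.
  by rewrite addr_ge0// ltW.
apply: (le_trans (ler_powRD_split f0 s0 (h0 k) (ltW q0))).
rewrite /V lerD2l (bigD1 (inord k))//= inordK ?ltnS//.
by rewrite indicE mem_set// mulr1 lerDl sumr_ge0.
Qed.

Lemma integral_tree_maximal_peak_le (u w f s q : R) m :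
  0 <= u <= f -> 0 <= w -> 0 < f -> 0 < s -> 0 < q ->
  (\int[mu]_x (tree_maximal mu T (fun y => (u + w * \1_(B m) y)%R) x `^ q) <=
   ((f + s) `^ q + (1 + f / s) `^ q * \sum_(k < m.+1)
      ((w * (N%:R ^+ k / N%:R ^+ m)) `^ q * N%:R ^- k))%R%:E)%E.
Proof.
move=> uf w0 f0 s0 q0.
apply: (@le_trans _ _ (\int[mu]_x _)%E).
  apply: ge0_le_integralT => x; first exact: poweR_ge0.
  exact: (tree_maximal_peak_le m x uf w0 f0 s0 q0).
pose c k := (1 + f / s) `^ q * (w * (N%:R ^+ k / N%:R ^+ m)) `^ q.
have c0 k : 0 <= c k by rewrite mulr_ge0// powR_ge0.
have cB0 k x : (0 <= (c k)%:E * (\1_(B k) x)%:E)%E.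
  by rewrite mule_ge0 ?lee_fin.
have mB k : measurable_fun setT (EFin \o (\1_(B k) : X -> R)).
  by apply/measurable_EFinP; exact: measurable_indic.
under eq_integral do rewrite EFinD -sumEFin.
under eq_integral do under eq_bigr do rewrite EFinM.
rewrite ge0_integralD//; first last.
- by apply: emeasurable_sum => k; exact: measurable_funeM (mB k).
- by move=> x _; apply: sume_ge0 => k _; exact: cB0.
- by move=> x _; rewrite lee_fin powR_ge0.
have -> : (\int[mu]_x ((f + s) `^ q)%:E = ((f + s) `^ q)%:E)%E.
  transitivity (((f + s) `^ q)%:E * mu setT)%E; first exact: integral_cst.
  by rewrite probability_setT mule1.
rewrite ge0_integral_sum//; first last.
- by move=> k x _; exact: cB0.
- by move=> k; exact: measurable_funeM (mB k).
rewrite EFinD leeD2l// mulr_sumr -sumEFin lee_sum// => k _.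
rewrite ge0_integralZl ?lee_fin//; [|exact: mB|exact: c0].
have -> : (\int[mu]_x (\1_(B k) x)%:E = (N%:R ^- k)%:E)%E.
  by rewrite integral_indic// setIT; exact: tree_level_measure.
by rewrite -EFinM mulrA.
Qed.

End Peak.

End Tree.

(** * The two bounds *)

Section Bounds.
Context {d : measure_display} {X : measurableType d} {R : realType}.
Variables (mu : probability X R) (N : nat) (T : set (set X)) (p q F f : R).
Hypotheses (N1 : (1 < N)%N) (hT : homogeneous_tree_like mu N T).
Hypotheses (p1 : 1 < p) (q0 : 0 < q) (qp : q < p) (F0 : 0 < F) (f0 : 0 < f).
Hypothesis fF : f `^ p <= F.

Lemma tree_maximal_ge_mean (phi : X -> R) x :
  (forall y, 0 <= phi y) -> (\int[mu]_y (phi y)%:E)%E = f%:E ->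
  (f%:E <= tree_maximal mu T phi x)%E.
Proof.
move=> phi0 phif; apply: ereal_sup_ubound; exists setT.
  by have [_ [C [[TX _] _ _]]] := hT.
rewrite /average probability_setT inve1 mule1 -phif.
by apply: eq_integral => y _; rewrite ger0_norm.
Qed.

Lemma bellman_ge : ((f `^ q)%:E <= bellman mu T p q F f)%E.
Proof.
apply/ereal_infP => _ [phi [mphi phi0 phif _] <-].
have -> : ((f `^ q)%:E = \int[mu]_x (f `^ q)%:E)%E.
  transitivity ((f `^ q)%:E * mu setT)%E.
    by rewrite probability_setT mule1.
  by apply/esym; exact: integral_cst.
apply: ge0_le_integralT => x; first by rewrite lee_fin powR_ge0.
have Mf := tree_maximal_ge_mean x phi0 phif.
rewrite -poweR_EFin; apply: (gt0_ler_poweR _ _ _ Mf); rewrite ?(ltW q0)//.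
  by rewrite in_itv /= leey lee_fin ltW.
by rewrite in_itv /= leey andbT (le_trans _ Mf)// lee_fin ltW.
Qed.

Lemma bellman_le_add (s e : R) : 0 < s -> 0 < e ->
  (bellman mu T p q F f <= ((f + s) `^ q + e)%:E)%E.
Proof.
move=> s0 e0; have [Tmeas [C [[TX TC] TE _]]] := hT.
have [B [lB Bdecr]] := tree_branch N1 TC TE.
have p0 : 0 < p by exact: lt_trans p1.
pose c := Num.min (1 - q / p) (q - q / p).
have c0 : 0 < c.
  rewrite lt_min !subr_gt0 ltr_pdivrMr// mul1r qp/= ltr_pdivrMr//.
  by rewrite ltr_pMr.
pose K := (1 + f / s) `^ q * F `^ (q / p).
have lim1 := cvg_natM_expr (natr_powRN_lt1 N1 c0).
(* [Fs] lets [two_value_moments] reach the moment [F]; [Ke] makes the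
   contribution of the peak at most [e]. *)
have [m [s1 Fs Ke]] : exists m, [/\ 0 < (N%:R ^- m : R) <= 1,
    F <= N%:R ^- m * (f / (2 * N%:R ^- m)) `^ p &
    K * (m.+1%:R * (N%:R `^ (- c)) ^+ m) <= e].
  have p10 : 0 < p - 1 by rewrite subr_gt0.
  have /andP[r0 r1] := natr_powRN_lt1 N1 p10.
  have lim2 : (fun m => F * (N%:R `^ (- (p - 1))) ^+ m) @ \oo --> (0 : R).
    by rewrite -(mulr0 F); apply: cvgMr; apply: cvg_expr; rewrite ger0_norm.
  have lim3 : (fun m => K * (m.+1%:R * (N%:R `^ (- c)) ^+ m)) @ \oo --> (0 : R).
    by rewrite -(mulr0 K); exact: cvgMr.
  have f2p : 0 < (f / 2) `^ p by apply: powR_gt0; rewrite divr_gt0.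
  have : \forall m \near \oo, F * (N%:R `^ (- (p - 1))) ^+ m <= (f / 2) `^ p /\
      K * (m.+1%:R * (N%:R `^ (- c)) ^+ m) <= e.
    near=> m; split.
    - by apply: ltW; near: m; exact: cvgr_lt lim2 _ f2p.
    - by apply: ltW; near: m; exact: cvgr_lt lim3 _ e0.
  move=> [m _ /(_ m (leqnn m))[Fm Km]].
  have n0 : 0 < N%:R :> R by rewrite ltr0n ltnW.
  have t0 : 0 < N%:R ^+ m :> R by rewrite exprn_gt0.
  exists m; split => //.
    by rewrite invr_gt0 t0 invf_le1// exprn_ege1// ler1n ltnW.
  rewrite invfM invrK mulrA powRM ?exprn_ge0 ?divr_ge0 ?(ltW f0)//.
  move: Fm; rewrite -powR_mulrn ?powR_ge0// -powRrM (mulrC (- (p - 1))) powRrM.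
  rewrite powR_mulrn ?(ltW n0)// powRN ler_pdivrMr ?powR_gt0// => Fm.
  rewrite mulrCA -(mulr_powRB1 (ltW t0) p0) (mulrA _^-1).
  by rewrite mulVf ?mul1r ?gt_eqF.
have [u [w [u0 w0 uf uw1 uwp]]] := two_value_moments s1 (ltW p0) f0 fF Fs.
have muB : mu (B m) = (N%:R ^- m)%:E := tree_level_measure TC TE (lB m).
have mB : measurable (B m) by apply: Tmeas; exact: (tree_level_sub TE (lB m)).
have step a b : 0 <= a -> 0 <= b ->
    (\int[mu]_x (a + b * \1_(B m) x)%:E = (a + b * N%:R ^- m)%:E)%E.
  by move=> a0 b0; rewrite integral_step// probability_setT mule1 setIT muB.
apply: ge_ereal_inf; exists (\int[mu]_x
    (tree_maximal mu T (fun y => (u + w * \1_(B m) y)%R) x `^ q))%E.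
  exists (fun y => u + w * \1_(B m) y) => //; split.
  - by apply: measurable_funD => //; apply: measurable_funM.
  - by move=> x; rewrite addr_ge0 ?mulr_ge0// ltW.
  - by rewrite step ?uw1// ltW.
  - rewrite -uwp -step ?powR_ge0//; last first.
      by rewrite subr_ge0 ge0_ler_powR
        ?nnegrE ?addr_ge0 ?lerDl ?(ltW u0) ?(ltW p0).
    apply: eq_integral => x _; congr EFin; rewrite indicE.
    by case: (x \in B m); rewrite ?mulr1 ?mulr0 ?addr0// [RHS]addrC subrK.
have uf' : 0 <= u <= f by rewrite (ltW u0) uf.
have := integral_tree_maximal_peak_le N1 Tmeas TX TC TE lB Bdecr m
  uf' w0 f0 s0 q0.
move=> /le_trans; apply.
rewrite lee_fin lerD2l; apply: le_trans Ke; rewrite /K -mulrA.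
rewrite ler_wpM2l ?powR_ge0// mulrCA -[m.+1 in leRHS]card_ord.
rewrite mulr_natl -sumr_const.
apply: ler_sum => k _; apply: peak_term_le => //; first exact: ltW.
  by rewrite -ltnS.
(* The height of the peak is controlled by its share of the p-th moment. *)
have : w `^ p <= (u + w) `^ p.
  by apply: ge0_ler_powR; rewrite ?nnegrE ?addr_ge0 ?lerDr ?(ltW u0) ?(ltW p0).
have := powR_ge0 u p; move: s1 => /andP[]; rewrite -uwp; nra.
Unshelve. all: by end_near. Qed.

Lemma bellman_le : (bellman mu T p q F f <= (f `^ q)%:E)%E.
Proof.
apply/lee_addgt0Pr => e e0.
have e20 : 0 < e / 2 by rewrite divr_gt0.
have /(_ _ (f `^ q + e / 2)) := cvgr_lt _ (continuous_powR (p := q) f0).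
rewrite ltrDl => /(_ e20) /nbhs_ballP[r /= r0 rq].
have [s s0 fs] : exists2 s, 0 < s & (f + s) `^ q <= f `^ q + e / 2.
  exists (r / 2); first by rewrite divr_gt0.
  apply/ltW/rq; rewrite /ball /= opprD addrA subrr sub0r normrN.
  by rewrite ger0_norm ?divr_ge0 ?(ltW r0)// ltr_pdivrMr// ltr_pMr// ltr1n.
apply: (le_trans (bellman_le_add s0 e20)).
by rewrite -EFinD lee_fin [in leRHS](splitr e) addrA lerD2r.
Qed.

End Bounds.

Theorem proposition1 (R : realType) (d : measure_display)
  (X : measurableType d) (mu : probability X R) (N : nat)
  (T : set (set X)) (p q F f : R)
  (hN : (1 < N)%N)
  (hmu : nonatomic mu)
  (hT : homogeneous_tree_like mu N T)
  (hp : 1 < p) (hq0 : 0 < q) (hqp : q < p)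
  (hF : 0 < F) (hf : 0 < f)
  (hfF : f `^ p <= F) :
  bellman mu T p q F f = (f `^ q)%:E.
Proof.
by apply: le_anti; rewrite (bellman_le hN hT)// (bellman_ge p F hT).
Qed.
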